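(* Let $(B_t)_{t \in \mathbb{N}}$ be a sequence of maximal lattice-free polytopes in $\mathbb{R}^n$ that converges in the Hausdorff metric and whose limit $B$ is a maximal lattice-free polytope. If, for every $t \in \mathbb{N}$, the set $B_t$ has the unique-lifting property, then $B$ too has the unique-lifting property.
   Context: A set $B\subseteq\mathbb{R}^n$ is lattice-free if it is $n$-dimensional, closed, convex and $\operatorname{int}(B)\cap\mathbb{Z}^n=\emptyset$; it is maximal lattice-free if it is inclusion-maximal among lattice-free sets. For $f\in\mathbb{R}^n\setminus\mathbb{Z}^n$, a cut-generating pair for $f$ is a pair of nonnegative functions $\psi,\pi:\mathbb{R}^n\to\mathbb{R}$ such that for all integers $k,\ell\ge 0$, not both zero, and all matrices $R\in\mathbb{R}^{n\times k}$ with columns $r_1,\dots,r_k$ and $P\in\mathbb{R}^{n\times \ell}$ with columns $p_1,\dots,p_\ell$, the inequality $\sum_{i=1}^k\psi(r_i)s_i+\sum_{j=1}^\ell\pi(p_j)y_j\ge 1$ holds for every $(s,y)\in\mathbb{R}_+^k\times\mathbb{Z}_+^\ell$ with $f+Rs+Py\in\mathbb{Z}^n$. In this case $\pi$ is called a lifting of $\psi$. A lifting $\pi'$ of $\psi$ dominates a lifting $\pi''$ if $\pi'(r)\le\pi''(r)$ for all $r\in\mathbb{R}^n$; a minimal lifting is a lifting not dominated by another, distinct lifting. For a lattice-free set $B$ and $f\in\operatorname{int}(B)$, the gauge function of $B-f$ is $\phi_{B-f}(r)=\inf\{\rho>0: r/\rho\in B-f\}$. A maximal lattice-free polytope $B$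 has the unique-lifting property if for every (equivalently, for some) $f\in\operatorname{int}(B)$ the function $\phi_{B-f}$ has exactly one minimal lifting. Known characterization from earlier literature, used by the paper as a working description: for a maximal lattice-free polytope $B$ and $f\in\operatorname{int}(B)$, $\phi_{B-f}$ has exactly one minimal lifting if and only if $R(B,f)+\mathbb{Z}^n=\mathbb{R}^n$, where $R(B,f)=\bigcup_{F}\bigcup_{z\in F\cap\mathbb{Z}^n}\bigl[\operatorname{conv}(\{f\}\cup F)\cap(z+f-\operatorname{conv}(\{f\}\cup F))\bigr]$, with $F$ ranging over all faces of $B$ other than $\emptyset$ and $B$. The Hausdorff distance of nonempty compact sets $K,L\subseteq\mathbb{R}^n$ is $\min\{\rho\ge 0: K\subseteq L+\rho\mathbb{B},\ L\subseteq K+\rho\mathbb{B}\}$, where $\mathbb{B}$ is the closed Euclidean unit ball centered at the origin. *)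

(* Defs.v *)
From mathcomp Require Import all_boot all_order all_algebra.
From mathcomp Require Import all_classical all_reals all_analysis.

Set Implicit Arguments.
Unset Strict Implicit.
Unset Printing Implicit Defensive.

Import Order.TTheory GRing.Theory Num.Theory.
Import numFieldNormedType.Exports.

Local Open Scope classical_set_scope.
Local Open Scope ring_scope.

(* R^n is the space 'cV[R]_n of column vectors.  Its library topology comes from
   the sup norm, hence is the usual one; the Euclidean norm is defined below. *)
Section LatticeFree.
Variables (R : realType) (n : nat).
Implicit Types (A B C K L : set 'cV[R]_n) (f r x : 'cV[R]_n).
Implicit Types psi pi : 'cV[R]_n -> R.

Definition integral_points : set 'cV[R]_n :=
  [set x | forall i, x i 0 \is a Num.int].

Definition affine_set A : Prop :=
  forall x y (t : R), A x -> A y -> A (t *: x + (1 - t) *: y).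

Definition affine_hull A : set 'cV[R]_n := smallest affine_set A.

Definition convex_hull A : set 'cV[R]_n := smallest (@convex_set R 'cV[R]_n) A.

(* dim B = n, the dimension of a set being that of its affine hull. *)
Definition full_dimensional B : Prop := affine_hull B = [set: 'cV[R]_n].

Definition lattice_free B : Prop :=
  [/\ full_dimensional B, closed B, @convex_set R 'cV[R]_n B
    & B° `&` integral_points = set0].

Definition maximal_lattice_free B : Prop :=
  lattice_free B /\ forall C, lattice_free C -> B `<=` C -> C = B.

Definition polytope B : Prop :=
  exists2 V : set 'cV[R]_n, finite_set V & B = convex_hull V.

Definition maximal_lattice_free_polytope B : Prop :=
  maximal_lattice_free B /\ polytope B.

(* The condition that f is not integral is part of the definition.  The vectors
   of Z_+^l are the real vectors whose entries are all in Num.nat. *)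
Definition cut_generating_pair f psi pi : Prop :=
  [/\ ~ integral_points f, (forall r, 0 <= psi r), (forall r, 0 <= pi r)
    & forall (k l : nat), (k != 0) || (l != 0) ->
      forall (M : 'M[R]_(n, k)) (P : 'M[R]_(n, l)) (s : 'cV[R]_k) (y : 'cV[R]_l),
        (forall i, 0 <= s i 0) -> (forall j, y j 0 \is a Num.nat) ->
        integral_points (f + M *m s + P *m y) ->
        1 <= \sum_(i < k) psi (col i M) * s i 0
             + \sum_(j < l) pi (col j P) * y j 0].

Definition lifting f psi pi : Prop := cut_generating_pair f psi pi.

Definition dominates (pi' pi'' : 'cV[R]_n -> R) : Prop :=
  forall r, pi' r <= pi'' r.

Definition minimal_lifting f psi pi : Prop :=
  lifting f psi pi /\
  ~ exists pi', [/\ lifting f psi pi', pi' <> pi & dominates pi' pi].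

(* When 0 is interior to K, the infimum is over a nonempty set. *)
Definition gauge_function K r : R :=
  inf [set rho : R | 0 < rho /\ K (rho^-1 *: r)].

Definition unique_lifting_property B : Prop :=
  forall f, B° f ->
    exists! pi, minimal_lifting f (gauge_function [set x - f | x in B]) pi.

Definition euclidean_norm x : R := Num.sqrt (\sum_(i < n) x i 0 ^+ 2).

Definition unit_ball : set 'cV[R]_n := [set x | euclidean_norm x <= 1].

(* L + rho * unit_ball *)
Definition parallel_body L (rho : R) : set 'cV[R]_n :=
  [set x + rho *: b | x in L & b in unit_ball].

(* For nonempty compact K and L the infimum is a minimum. *)
Definition hausdorff_distance K L : R :=
  inf [set rho : R | [/\ 0 <= rho, K `<=` parallel_body L rho
                       & L `<=` parallel_body K rho]].

End LatticeFree.

(* Main.v *)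
Require Import Defs.
From mathcomp Require Import all_boot all_order all_algebra.
From mathcomp Require Import all_classical all_reals all_analysis.
From mathcomp Require Import ring lra.

Set Implicit Arguments.
Unset Strict Implicit.
Unset Printing Implicit Defensive.

Import Order.TTheory GRing.Theory Num.Theory.
Import numFieldNormedType.Exports.
Local Open Scope classical_set_scope.
Local Open Scope ring_scope.

(** Write psi for the gauge of B - f and let sigma be its periodization,
    sigma r = inf of psi (r + w) over integral w.  Then sigma is a lifting of
    psi, every lifting pi satisfies pi p >= 1 - sigma (- f - p), and both facts
    together show that the condition

      (S)   sigma p + sigma (- f - p) <= 1   for all p

    makes sigma the least lifting, hence the only minimal one
    (symmetric_unique_minimal_lifting).  Condition (S) is an analytic form of
    the covering of space by the integral translates of R(B, f), and it passes
    to limits directly: if B_t is close to B, then B_t - f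
    is contained in (1 + e) (B - f), so sigma_B <= (1 + e) sigma_(B_t), and the
    left-hand side of (S) for B is at most 1 + e.

    What remains is the converse: uniqueness implies (S)
    (unique_minimal_lifting_symmetric).  By Zorn's lemma every lifting lies
    above a minimal one, so a unique minimal lifting pi is the least lifting.
    Consequently pi p cannot be decreased at a single point p: changing sigma
    at p to the value c gives a lifting as soon as
    sigma (- f - N p) + N c >= 1 for all N, so for pi p > 0 some N >= 1 has
    sigma (- f - N p) + N pi p <= 1 (least_lifting_tight).  The same holds at
    q = - f - p with some N', both values being positive unless p or q is
    integral.  If N = 1 or N' = 1, then subadditivity of sigma
    yields (S) at p.  If N, N' >= 2, then pi p <= 1/2 and pi q <= 1/2, while
    pi p + pi q >= 1; so pi p = 1/2, N = 2 and sigma (- f - 2 p) = 0.  As psi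
    vanishes only at the origin, this confines p to a discrete set, and (S)
    extends to that set because sigma cannot drop abruptly
    (le_periodization_shift).

    The unique-lifting property of B_t is a statement about points in the
    interior of B_t, so one also needs that f is interior to B_t for large t.
    If a ball around f lies in B_t + rho * ball, then the ball with radius
    smaller by rho lies in B_t; this cancellation (ball_in_of_parallel) follows
    from averaging and needs no separation theorem. *)

(** * Liftings of a sublinear function *)

Section LatticeFreeLimits.
Variables (R : realType) (n : nat).
Implicit Types (psi : 'cV[R]_n -> R) (f p r w z : 'cV[R]_n).

Local Notation Zn := (@integral_points R n).

Lemma integral0 : Zn 0.
Proof. by move=> i; rewrite mxE rpred0. Qed.

Lemma integralD w z : Zn w -> Zn z -> Zn (w + z).
Proof. by move=> wZ zZ i; rewrite mxE rpredD. Qed.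

Lemma integralN w : Zn w -> Zn (- w).
Proof. by move=> wZ i; rewrite mxE rpredN. Qed.

Record sublinear psi : Prop := Sublinear {
  sublinearD : forall x y, psi (x + y) <= psi x + psi y;
  sublinearZ : forall (s : R) x, 0 <= s -> psi (s *: x) <= s * psi x;
  sublinear_ge0 : forall x, 0 <= psi x
}.

Lemma sublinear0 psi : sublinear psi -> psi 0 = 0.
Proof.
move=> sub; apply/eqP; rewrite eq_le (sublinear_ge0 sub) andbT.
by have := sublinearZ sub 0 (lexx _); rewrite scale0r mul0r.
Qed.

Lemma subadditive_sum psi (I : finType) (P : pred I) (F : I -> 'cV[R]_n) :
    (forall x y, psi (x + y) <= psi x + psi y) -> psi 0 = 0 ->
  psi (\sum_(i | P i) F i) <= \sum_(i | P i) psi (F i).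
Proof.
move=> subD psi0; elim/big_ind2 : _ => [|x a y b xa yb|//]; first by rewrite psi0.
exact: le_trans (subD _ _) (lerD xa yb).
Qed.

Lemma mulmx_sum_col m k (A : 'M[R]_(m, k)) (u : 'cV[R]_k) :
  A *m u = \sum_(i < k) u i 0 *: col i A.
Proof.
apply/colP => i; rewrite !mxE summxE; apply: eq_bigr => j _.
by rewrite !mxE mulrC.
Qed.

Definition periodization psi r : R := inf [set psi (r + w) | w in Zn].

Section Periodization.
Variable psi : 'cV[R]_n -> R.
Hypothesis psiS : sublinear psi.

Local Notation sigma := (periodization psi).

Lemma periodization_le r w : Zn w -> sigma r <= psi (r + w).
Proof.
move=> wZ; apply: ge_inf; last by exists w.
by exists 0 => _ [v _ <-]; exact: sublinear_ge0.
Qed.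

Lemma le_periodization r (c : R) :
  (forall w, Zn w -> c <= psi (r + w)) -> c <= sigma r.
Proof.
move=> cpsi; apply: lb_le_inf; first by exists (psi (r + 0)), 0; [exact: integral0|].
by move=> _ [w wZ <-]; exact: cpsi.
Qed.

Lemma periodization_le0 r : sigma r <= psi r.
Proof. by rewrite -{2}[r]addr0; apply: periodization_le; exact: integral0. Qed.

Lemma periodization_ge0 r : 0 <= sigma r.
Proof. by apply: le_periodization => w _; exact: sublinear_ge0. Qed.

Lemma periodization0 : sigma 0 = 0.
Proof.
apply/eqP; rewrite eq_le periodization_ge0 andbT.
by apply: le_trans (periodization_le0 0) _; rewrite sublinear0.
Qed.

Lemma periodizationD_int r w : Zn w -> sigma (r + w) = sigma r.
Proof.
have H x v : Zn v -> sigma x <= sigma (x + v).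
  move=> vZ; apply: le_periodization => u uZ.
  by rewrite -addrA; apply: periodization_le; exact: integralD.
move=> wZ; apply/eqP; rewrite eq_le H// andbT.
by rewrite -{2}[r](addrK w); apply: H; exact: integralN.
Qed.

Lemma periodizationD x y : sigma (x + y) <= sigma x + sigma y.
Proof.
rewrite -lerBlDr; apply: le_periodization => w wZ.
rewrite lerBlDr -lerBlDl; apply: le_periodization => v vZ.
rewrite lerBlDl; apply: le_trans (periodization_le _ (integralD wZ vZ)) _.
by rewrite addrACA; exact: sublinearD.
Qed.

Lemma periodizationMn x N : sigma (x *+ N) <= N%:R * sigma x.
Proof.
elim: N => [|N IH]; first by rewrite mulr0n mul0r periodization0.
rewrite mulrS (le_trans (periodizationD _ _))// -natr1 mulrDl mul1r.
by rewrite [leRHS]addrC lerD2l.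
Qed.

(** One-sided Lipschitz estimate: it transfers an upper bound on sigma from a
    point x to a nearby point y. *)
Lemma le_periodization_shift x y : sigma y - psi (y - x) <= sigma x.
Proof.
rewrite lerBlDr.
have := periodizationD x (y - x); rewrite addrC subrK => /le_trans; apply.
by rewrite lerD2l periodization_le0.
Qed.

End Periodization.

Section Lifting.
Variables (f : 'cV[R]_n) (psi : 'cV[R]_n -> R).
Hypothesis psiS : sublinear psi.
Hypothesis fZ : ~ Zn f.
Hypothesis psi_lattice : forall z, Zn z -> 1 <= psi (z - f).

Local Notation sigma := (periodization psi).

Lemma periodization_Nf_ge1 : 1 <= sigma (- f).
Proof. by apply: le_periodization => w wZ; rewrite addrC; exact: psi_lattice. Qed.

(** The integer variables whose column is p contribute p *+ N in total; moving
    this term to the other side leaves a combination that subadditivity bounds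
    below by sigma (- f - p *+ N).  So validity at all N is all that a new
    value c at p requires. *)
Lemma lifting_modified_periodization p (c : R) : 0 <= c ->
    (forall N, 1 <= sigma (- f - p *+ N) + N%:R * c) ->
  lifting f psi (fun r => if r == p then c else sigma r).
Proof.
move=> c0 cN; split=> //.
- exact: sublinear_ge0.
- by move=> r; case: ifP => // _; exact: periodization_ge0.
move=> k l _ M P s y s0 yN fZy.
have ytr j : y j 0 = (Num.truncn (y j 0))%:R by rewrite truncnK.
pose N := (\sum_(j | col j P == p) Num.truncn (y j 0%R))%N.
have Ms : sigma (M *m s) <= \sum_i psi (col i M) * s i 0.
  rewrite mulmx_sum_col (le_trans (periodization_le0 psiS _))//.
  apply: le_trans (subadditive_sum _ _ (sublinearD psiS) (sublinear0 psiS)) _.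
  by apply: ler_sum => i _; rewrite mulrC; exact: sublinearZ.
rewrite [X in _ + X](bigID (fun j => col j P == p))/=.
have -> : \sum_(j | col j P == p)
    (if col j P == p then c else sigma (col j P)) * y j 0 = N%:R * c.
  rewrite natr_sum mulr_suml; apply: eq_bigr => j ->.
  by rewrite mulrC -ytr.
pose x := \sum_(j | col j P != p) y j 0 *: col j P.
have xs : sigma x <= \sum_(j | col j P != p)
    (if col j P == p then c else sigma (col j P)) * y j 0.
  apply: le_trans (subadditive_sum _ _ (periodizationD psiS) (periodization0 psiS)) _.
  apply: ler_sum => j /negbTE ->; rewrite ytr scaler_nat mulrC.
  exact: periodizationMn.
have Py : P *m y = p *+ N + x.
  rewrite mulmx_sum_col (bigID (fun j => col j P == p))/=; congr (_ + _).
  rewrite -scaler_nat natr_sum scaler_suml; apply: eq_bigr => j /eqP ->.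
  by rewrite -ytr.
have e : - f - p *+ N + (f + M *m s + P *m y) = M *m s + x.
  by rewrite Py; apply/matrixP => i j; rewrite !mxE; ring.
have := cN N.
rewrite -(periodizationD_int psiS (- f - p *+ N) fZy) e.
have := periodizationD psiS (M *m s) x.
lra.
Qed.

Lemma lifting_periodization : lifting f psi sigma.
Proof.
rewrite (_ : sigma = fun r => if r == 0 then sigma 0 else sigma r); last first.
  by apply/funext => r; case: eqP => // ->.
apply: lifting_modified_periodization; first exact: periodization_ge0.
by move=> N; rewrite periodization0// mul0rn subr0 mulr0 addr0 periodization_Nf_ge1.
Qed.

(** The instance with the two integer columns p and - f - p, each used once. *)
Lemma lifting_pair_ge1 pi : lifting f psi pi -> forall p, 1 <= pi p + pi (- f - p).
Proof.
move=> [_ _ _ H] p.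
have := H 0 2 isT 0 (\matrix_(i, j) (if j == 0 then p i 0 else (- f - p) i 0))
  0 (const_mx 1).
rewrite big_ord0 add0r !big_ord_recl big_ord0 addr0 !mxE !mulr1.
have -> : col 0 (\matrix_(i < n, j < 2) (if j == 0 then p i 0 else (- f - p) i 0)) = p.
  by apply/colP => i; rewrite !mxE.
have -> : col (lift 0 0) (\matrix_(i < n, j < 2)
    (if j == 0 then p i 0 else (- f - p) i 0)) = - f - p.
  by apply/colP => i; rewrite !mxE.
apply=> [[]//|j|]; first by rewrite mxE.
rewrite mulmx0 addr0 => i.
rewrite !mxE !big_ord_recl big_ord0 !mxE/=.
by rewrite (_ : _ + _ = 0) ?rpred0//; ring.
Qed.

(** The instance with one integer column p and one continuous column
    - f - p + w, followed by the supremum over integral w. *)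
Lemma lifting_ge pi : lifting f psi pi -> forall p, 1 - sigma (- f - p) <= pi p.
Proof.
move=> [_ _ _ H] p; rewrite lerBlDr -lerBlDl; apply: le_periodization => w wZ.
rewrite lerBlDr.
have := H 1 1 isT (- f - p + w) p (const_mx 1) (const_mx 1).
rewrite !big_ord_recl !big_ord0 !addr0 !mxE !mulr1.
have colE (v : 'cV[R]_n) : col 0 v = v by apply/colP => i; rewrite !mxE.
rewrite !colE; apply=> [i|j|]; [by rewrite mxE ler01| by rewrite mxE |].
have mulE (v : 'cV[R]_n) : v *m const_mx 1 = v.
  by apply/colP => i; rewrite !mxE big_ord_recl big_ord0 addr0 mxE mulr1.
rewrite !mulE (_ : _ + _ = w)//.
by apply/colP => i; rewrite !mxE; ring.
Qed.

End Lifting.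

(** * Minimal liftings *)

(** On finitely many points, the infimum of a chain is nearly attained by a
    single member; validity of a lifting only ever tests finitely many points,
    which is why it survives infima of chains. *)
Lemma chain_near_inf (C : set ('cV[R]_n -> R)) (s : seq 'cV[R]_n) (e : R) :
    C !=set0 -> (forall a, C a -> forall r, 0 <= a r) ->
    total_on C (@dominates R n) -> 0 < e ->
  exists2 a, C a & {in s, forall r, a r <= inf [set b r | b in C] + e}.
Proof.
move=> [a0 Ca0] Cge0 Ctot e0; elim: s => [|x s [a Ca aP]]; first by exists a0.
have [] := @inf_adherent _ [set b x | b in C] _ e0.
  split; first by exists (a0 x), a0.
  by exists 0 => _ [b Cb <-]; exact: Cge0.
move=> _ [b Cb <-] bx.
have [ab|ba] := Ctot _ _ Ca Cb.
- exists a => // r; rewrite inE => /predU1P[->|/aP//].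
  exact: le_trans (ab x) (ltW bx).
- exists b => // r; rewrite inE => /predU1P[->|/aP]; first exact: ltW.
  exact: le_trans (ba r).
Qed.

Lemma lifting_chain_inf f psi (C : set ('cV[R]_n -> R)) :
    C !=set0 -> (forall a, C a -> lifting f psi a) ->
    total_on C (@dominates R n) ->
  lifting f psi (fun r => inf [set a r | a in C]).
Proof.
move=> C0 Clift Ctot; have [a0 Ca0] := C0.
have Cge0 a : C a -> forall r, 0 <= a r by move=> /Clift[].
have [fZ psi0 _ _] := Clift _ Ca0.
split=> // [r|k l kl M P s y s0 yN fZy].
  by apply: lb_le_inf; [exists (a0 r), a0 | move=> _ [a Ca <-]; exact: Cge0].
have y0 j : 0 <= y j 0 by rewrite natr_ge0.
apply/ler_addgt0Pr => e e0.
pose Y := \sum_j y j 0; have Y0 : 0 <= Y by exact: sumr_ge0.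
(* The total weight of the integer columns is Y, so this error adds up to less
   than e; the summand 1 only keeps the denominator positive. *)
have [|a Ca aP] :=
    @chain_near_inf C [seq col j P | j : 'I_l] (e / (1 + Y)) C0 Cge0 Ctot.
  by rewrite divr_gt0// ltr_wpDr.
have [_ _ _ /(_ _ _ kl M P s y s0 yN fZy)] := Clift _ Ca.
move=> /le_trans; apply; rewrite -addrA lerD2l.
apply: (@le_trans _ _ (\sum_j (inf [set b (col j P) | b in C] * y j 0
                             + e / (1 + Y) * y j 0))).
  apply: ler_sum => j _; rewrite -mulrDl ler_wpM2r//.
  by apply: aP; apply/mapP; exists j; rewrite // mem_enum.
rewrite big_split/= lerD2l -mulr_sumr -/Y mulrAC ler_pdivrMr ?ltr_wpDr//.
by rewrite ler_pM2l// lerDr.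
Qed.

Lemma minimal_lifting_below f psi L : lifting f psi L ->
  exists2 pi, minimal_lifting f psi pi & dominates pi L.
Proof.
move=> Llift; pose P a := lifting f psi a /\ dominates a L.
pose T := {a : 'cV[R]_n -> R | P a}.
pose rel_dom (a b : T) := `[< dominates (sval b) (sval a) >].
have [||||[pi [pi_lift piL]] pi_max] := @Zorn T rel_dom.
- by move=> a; apply/asboolP => r.
- move=> a b c /asboolP ba /asboolP cb; apply/asboolP => r.
  exact: le_trans (cb r) (ba r).
- move=> [a aP] [b bP] /asboolP/= ba /asboolP/= ab; apply/eq_exist/funext => r.
  by apply/eqP; rewrite eq_le ab ba.
- move=> A Atot; have [[a0 Aa0]|A0] := pselect (A !=set0); last first.
    exists (exist P L (conj Llift (fun r => lexx (L r)))) => a Aa.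
    by exfalso; apply: A0; exists a.
  pose C := [set sval a | a in A].
  have Cinf r c : C c -> inf [set b r | b in C] <= c r.
    move=> Cc; apply: ge_inf; last by exists c.
    by exists 0 => _ [_ [b _ <-] <-]; case: (svalP b) => -[].
  have Clift : lifting f psi (fun r => inf [set a r | a in C]).
    apply: lifting_chain_inf.
    + by exists (sval a0), a0.
    + by move=> _ [a _ <-]; case: (svalP a).
    + move=> _ _ [a Aa <-] [b Ab <-].
      by case: (Atot a b Aa Ab) => /asboolP; [right|left].
  have CL : dominates (fun r => inf [set a r | a in C]) L.
    move=> r; apply: le_trans (Cinf r (sval a0) _) _; first by exists a0.
    by case: (svalP a0).
  exists (exist P _ (conj Clift CL)) => a Aa; apply/asboolP => r.
  by apply: Cinf; exists a.
exists pi => //; split => // -[pi' [pi'_lift pi'_neq pi'_dom]].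
have pi'L : dominates pi' L by move=> r; exact: le_trans (pi'_dom r) (piL r).
have /= := pi_max (exist P pi' (conj pi'_lift pi'L)).
by move=> /(_ (asboolT pi'_dom))/(congr1 sval).
Qed.

Lemma unique_minimal_lifting_least f psi :
    (exists! pi, minimal_lifting f psi pi) ->
  exists2 pi, lifting f psi pi & forall L, lifting f psi L -> dominates pi L.
Proof.
move=> [pi [[pi_lift pi_min] pi_uniq]]; exists pi => // L.
by move=> /minimal_lifting_below[pi' /pi_uniq <-].
Qed.

Lemma least_unique_minimal_lifting f psi pi : lifting f psi pi ->
    (forall L, lifting f psi L -> dominates pi L) ->
  exists! pi, minimal_lifting f psi pi.
Proof.
move=> pi_lift pi_least; exists pi; split.
  split=> // -[pi' [/pi_least pipi' pi'_neq pi'_dom]]; apply: pi'_neq.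
  by apply/funext => r; apply/eqP; rewrite eq_le pi'_dom pipi'.
move=> pi' [/pi_least pipi' pi'_min].
apply: contrapT => pi_neq; apply: pi'_min; exists pi; split=> //.
Qed.

(** * Uniqueness of the minimal lifting *)

(** For liftings pi the inequality pi p + pi (- f - p) >= 1 always holds, so
    this says that the periodization satisfies the symmetry
    sigma p + sigma (- f - p) = 1 of minimal functions. *)
Definition periodization_symmetric f psi : Prop :=
  forall p, periodization psi p + periodization psi (- f - p) <= 1.

Lemma pos_lower_bound (g : nat -> R) (K : nat) : (forall N, 0 < g N) ->
  exists2 e, 0 < e & forall N, (N <= K)%N -> e <= g N.
Proof.
move=> g0; elim: K => [|K [e e0 eg]].
  by exists (g 0) => // N; rewrite leqn0 => /eqP ->.
exists (Num.min e (g K.+1)); first by rewrite lt_min e0 g0.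
move=> N; rewrite leq_eqVlt => /predU1P[->|/eg eN]; first by rewrite ge_min lexx orbT.
by rewrite ge_min eN.
Qed.

Lemma non_integer_right (a : R) :
  exists2 d, 0 < d & forall t, 0 < t -> t < d -> a + t \isn't a Num.int.
Proof.
have := floorD1_gt a; have := floor_le a; set m := Num.floor a => ma am.
exists ((m + 1)%:~R - a); first by rewrite subr_gt0.
move=> t t0 td; apply/negP => /intrP[z az].
have mz : m < z by rewrite -(ltr_int R) -az; lra.
have zm : z < m + 1 by rewrite -(ltr_int R) -az; lra.
by move: zm; rewrite ltzD1 leNgt mz.
Qed.

Lemma non_integer_far (a : R) : a \isn't a Num.int ->
  exists2 e, 0 < e & forall b, b \is a Num.int -> e <= `|a + b|.
Proof.
move=> aZ; have := floorD1_gt a; have := floor_le a.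
set m := Num.floor a => ma aM.
have am : m%:~R < a by rewrite lt_neqAle ma andbT; apply: contraNneq aZ => <-.
exists (Num.min (a - m%:~R) ((m + 1)%:~R - a)); first by rewrite lt_min !subr_gt0 am.
move=> b /intrP[z ->]; rewrite ge_min.
have [zm|mz] := leP (- z) m.
  apply/orP; left; rewrite (le_trans _ (ler_norm _))//.
  by move: zm; rewrite -(ler_int R) mulrNz; lra.
apply/orP; right; rewrite -normrN (le_trans _ (ler_norm _))//.
by move: mz; rewrite -lezD1 -(ler_int R) mulrNz; lra.
Qed.

Lemma coord_le_norm (x : 'cV[R]_n) i : `|x i 0| <= `|x|.
Proof.
rewrite [leRHS]/Num.norm/= mx_normrE.
exact: (le_bigmax _ (fun ij => `|x ij.1 ij.2|) (i, 0)).
Qed.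

Section Uniqueness.
Variables (f : 'cV[R]_n) (psi : 'cV[R]_n -> R) (M : R).
Hypothesis psiS : sublinear psi.
Hypothesis fZ : ~ Zn f.
Hypothesis psi_lattice : forall z, Zn z -> 1 <= psi (z - f).
Hypothesis M0 : 0 < M.
Hypothesis psi_lower : forall x, `|x| <= M * psi x.

Local Notation sigma := (periodization psi).

Lemma symmetric_unique_minimal_lifting : periodization_symmetric f psi ->
  exists! pi, minimal_lifting f psi pi.
Proof.
move=> sym; apply: (@least_unique_minimal_lifting _ _ sigma).
  exact: lifting_periodization.
move=> L /lifting_ge LP r; apply: le_trans (LP r).
by rewrite lerBrDr.
Qed.

(** Only the origin has gauge zero, so sigma can vanish at integral points
    only; one non-integral coordinate is enough to exclude this. *)
Lemma periodization_gt0 r i : r i 0 \isn't a Num.int -> 0 < sigma r.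
Proof.
move=> /non_integer_far[e e0 eP]; apply: (@lt_le_trans _ _ (e / M)).
  exact: divr_gt0.
apply: le_periodization => w wZ; rewrite ler_pdivrMr// mulrC.
apply: le_trans (psi_lower _); apply: le_trans (coord_le_norm _ i).
by rewrite mxE; exact: eP.
Qed.

Section LeastLifting.
Variable pi : 'cV[R]_n -> R.
Hypothesis pi_lift : lifting f psi pi.
Hypothesis pi_least : forall L, lifting f psi L -> dominates pi L.

Lemma least_le_periodization r : pi r <= sigma r.
Proof. exact: (pi_least (lifting_periodization psiS fZ psi_lattice)). Qed.

(** Otherwise all the conditions with N >= 1 in lifting_modified_periodization
    would be strict at c = pi p; the one for N = 0 is independent of c.  Those with N > 2 / pi p hold for every c >= pi p / 2,
    and finitely many strict ones leave room to decrease c. *)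
Lemma least_lifting_tight p : 0 < pi p ->
  exists N : nat, sigma (- f - p *+ N.+1) + N.+1%:R * pi p <= 1.
Proof.
set u := pi p => u0; apply: contrapT => /forallNP notP.
have {}notP N : 1 < sigma (- f - p *+ N.+1) + N.+1%:R * u.
  by rewrite ltNge; apply/negP; exact: notP.
pose g N := (sigma (- f - p *+ N.+1) + N.+1%:R * u - 1) / N.+1%:R.
pose K := Num.truncn (2 / u).
have Ku : 2 < K.+1%:R * u.
  by rewrite -ltr_pdivrMr//; exact: truncnS_gt.
have [|e e0 eg] := @pos_lower_bound g K.
  by move=> N; rewrite divr_gt0 ?ltr0n// subr_gt0.
pose c := Num.max (u / 2) (u - e).
have cu : c < u by rewrite gt_max; apply/andP; split; lra.
have c2 : u / 2 <= c by rewrite le_max lexx.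
have ce : u - e <= c by rewrite le_max lexx orbT.
have c0 : 0 <= c by lra.
(* c < pi p, so the modified function being a lifting contradicts leastness. *)
have := pi_least (lifting_modified_periodization psiS fZ c0 _).
suff H N : 1 <= sigma (- f - p *+ N) + N%:R * c.
  by move=> /(_ _ H p); rewrite eqxx leNgt cu.
case: N => [|N].
  by rewrite mulr0n subr0 mul0r addr0 periodization_Nf_ge1.
have N0 : 0 < N.+1%:R :> R by rewrite ltr0n.
have [/eg|KN] := leqP N K.
  rewrite /g ler_pdivlMr// => eN.
  have : N.+1%:R * (u - e) <= N.+1%:R * c by rewrite ler_wpM2l// ltW.
  by rewrite mulrBr [_ * e]mulrC; lra.
have : 0 <= sigma (- f - p *+ N.+1) by exact: periodization_ge0.
have : K.+1%:R * (u / 2) <= N.+1%:R * c.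
  by apply: ler_pM => //; rewrite ?ler_nat; [lra | rewrite ltnS ltnW].
by rewrite mulrA; lra.
Qed.

(** Tightness at p with N = 1 forces pi and sigma to agree at q = - f - p.
    Tightness at q with some N then gives
    sigma p <= sigma (- f - N q) + (N - 1) sigma q <= 1 - sigma q. *)
Lemma symmetric_of_first_tight p : 0 < pi (- f - p) ->
  sigma (- f - p) + pi p <= 1 -> sigma p + sigma (- f - p) <= 1.
Proof.
set q := - f - p => v0 qu.
have := lifting_pair_ge1 pi_lift p; rewrite -/q => uv.
have := least_le_periodization q => vq.
have vE : pi q = sigma q by lra.
have [N] := least_lifting_tight v0; rewrite vE => tight.
have pE : p = (- f - q *+ N.+1) + q *+ N.
  by rewrite mulrSr opprD addrA addrAC subrK /q; apply/matrixP => i j; rewrite !mxE; ring.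
have := periodizationD psiS (- f - q *+ N.+1) (q *+ N); rewrite -pE.
have := periodizationMn psiS q N.
by move: tight; rewrite -natr1 mulrDl mul1r; lra.
Qed.

(** The three positivity conditions exclude a discrete set of points p: the
    first two rule out pi p = 0 and pi (- f - p) = 0, the third the remaining
    case where p and - f - p are both tight with multiplicity at least 2. *)
Lemma symmetric_generic p : 0 < sigma p -> 0 < sigma (- f - p) ->
  0 < sigma (- f - p *+ 2) -> sigma p + sigma (- f - p) <= 1.
Proof.
set q := - f - p => p0 q0 pp0.
have qp : - f - q = p by rewrite /q; apply/matrixP => i j; rewrite !mxE; ring.
have := lifting_pair_ge1 pi_lift p; rewrite -/q => uv.
have up := least_le_periodization p; have vq := least_le_periodization q.
have mul_ge (N : nat) (x : R) : 0 < x -> 2 * x <= N.+2%:R * x.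
  by move=> x0; rewrite ler_pM2r// ler_nat.
have u0 : 0 < pi p.
  rewrite ltNge; apply/negP => u0.
  have v0 : 0 < pi q by lra.
  have [[|N]] := least_lifting_tight v0; first by rewrite mulr1n qp; lra.
  have := periodization_ge0 psiS (- f - q *+ N.+2).
  by have := mul_ge N _ v0; lra.
have v0 : 0 < pi q.
  rewrite ltNge; apply/negP => v0.
  have [[|N]] := least_lifting_tight u0; first by rewrite mulr1n -/q; lra.
  have := periodization_ge0 psiS (- f - p *+ N.+2).
  by have := mul_ge N _ u0; lra.
have [[|N]] := least_lifting_tight u0.
  by rewrite mulr1n mul1r; exact: symmetric_of_first_tight.
have [[|N']] := least_lifting_tight v0.
  rewrite mulr1n mul1r qp => H _; have -> : sigma p = sigma (- f - q) by rewrite qp.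
  by rewrite addrC; apply: symmetric_of_first_tight; rewrite qp.
(* N + 2 and N' + 2 are the multiplicities: both values of pi are then 1/2, and
   the multiplicity at p is exactly 2. *)
move=> H' H; exfalso.
have := periodization_ge0 psiS (- f - q *+ N'.+2).
have := periodization_ge0 psiS (- f - p *+ N.+2).
have := mul_ge N _ u0; have := mul_ge N' _ v0.
move=> h1 h2 h3 h4.
have u2 : pi p = 1 / 2 by lra.
case: N H h2 h3 => [|N] H h2 h3; first by rewrite u2 in H; lra.
have : 3 * pi p <= N.+3%:R * pi p by rewrite ler_pM2r// ler_nat.
lra.
Qed.

End LeastLifting.

(** Translating p slightly along the all-ones vector makes the points p, - f - p
    and - f - 2 p non-integral in a fixed coordinate, where symmetric_generic
    applies; le_periodization_shift brings the inequality back to p. *)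
Lemma unique_minimal_lifting_symmetric :
  (exists! pi, minimal_lifting f psi pi) -> periodization_symmetric f psi.
Proof.
move=> /unique_minimal_lifting_least[pi pi_lift pi_least] p.
(* Some coordinate exists: for n = 0 the point f would be integral. *)
have [i fi] : exists i, f i 0 \isn't a Num.int.
  by apply: contrapT => /forallNP fN; apply: fZ => i; apply: contrapT => /negP /fN.
apply/ler_addgt0Pr => e e0.
have [d1 d10 d1P] := non_integer_right (p i 0).
have [d2 d20 d2P] := non_integer_right (f i 0 + p i 0).
have [d3 d30 d3P] := non_integer_right (f i 0 + p i 0 *+ 2).
pose one : 'cV[R]_n := const_mx 1.
pose A := psi one; pose B := psi (- one).
have A0 : 0 <= A by exact: sublinear_ge0.
have B0 : 0 <= B by exact: sublinear_ge0.
have [t [t0 td1 td2 td3 te]] :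
    exists t, [/\ 0 < t, t < d1, t < d2, t + t < d3 & t * (A + B) <= e].
  pose C := e / (1 + (A + B)).
  have C0 : 0 < C by rewrite divr_gt0// ltr_wpDr// addr_ge0.
  have CE : C * (A + B) <= e.
    by rewrite mulrAC ler_pdivrMr ?ltr_wpDr ?addr_ge0// ler_pM2l// lerDr.
  exists (Num.min (Num.min (d1 / 2) (d2 / 2)) (Num.min (d3 / 3) C)).
  set t := Num.min _ _.
  have : t <= d1 / 2 by rewrite !ge_min lexx.
  have : t <= d2 / 2 by rewrite !ge_min lexx ?orbT.
  have : t <= d3 / 3 by rewrite !ge_min lexx ?orbT.
  have tC : t <= C by rewrite !ge_min lexx ?orbT.
  move=> h1 h2 h3.
  split; [| lra | lra | lra |]; first by rewrite !lt_min C0 !divr_gt0.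
  by apply: le_trans CE; rewrite ler_wpM2r// addr_ge0.
pose x := p + t *: one.
have pA : sigma p <= sigma x + t * B.
  have := le_periodization_shift psiS x p.
  have -> : p - x = t *: (- one).
    by apply/matrixP => ? ?; rewrite !mxE; ring.
  by have := sublinearZ psiS (- one) (ltW t0); rewrite -/B; lra.
have pB : sigma (- f - p) <= sigma (- f - x) + t * A.
  have := le_periodization_shift psiS (- f - x) (- f - p).
  have -> : - f - p - (- f - x) = t *: one.
    by apply/matrixP => ? ?; rewrite !mxE; ring.
  by have := sublinearZ psiS one (ltW t0); rewrite -/A; lra.
suff : sigma x + sigma (- f - x) <= 1 by lra.
apply: (symmetric_generic pi_lift pi_least);
  apply: (@periodization_gt0 _ i); rewrite !mxE.
- by rewrite mulr1; exact: d1P.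
- by rewrite mulr1 -opprD rpredN addrA; exact: d2P.
- rewrite mulr1 -opprD rpredN (_ : _ + _ = f i 0 + p i 0 *+ 2 + (t + t)); last by ring.
  by apply: d3P => //; lra.
Qed.

End Uniqueness.

(** * Gauge functions of translated convex bodies *)

Lemma convex_setP (A : set 'cV[R]_n) x y (t : R) :
  @convex_set R 'cV[R]_n A -> A x -> A y -> 0 <= t -> t <= 1 ->
  A (t *: x + (1 - t) *: y).
Proof.
move=> Aconv /mem_set xA /mem_set yA t0 t1.
by have := Aconv x y (Itv01 t0 t1) xA yA; rewrite inE.
Qed.

Section Gauge.
Variables (B : set 'cV[R]_n) (f : 'cV[R]_n) (d : R).
Hypothesis Bconv : @convex_set R 'cV[R]_n B.
Hypothesis d0 : 0 < d.
Hypothesis dB : forall x, `|x| <= d -> B (f + x).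

Local Notation psi := (gauge_function [set x - f | x in B]).

Lemma gauge_function_le x rho : 0 < rho -> B (f + rho^-1 *: x) -> psi x <= rho.
Proof.
move=> rho0 Bx; apply: ge_inf; first by exists 0 => ? [/ltW].
by split=> //; exists (f + rho^-1 *: x); rewrite // addrAC subrr add0r.
Qed.

Lemma le_gauge_function x (c : R) :
  (forall rho, 0 < rho -> B (f + rho^-1 *: x) -> c <= rho) -> c <= psi x.
Proof.
move=> cP; apply: lb_le_inf; last first.
  by move=> rho [rho0 [y By yE]]; apply: cP => //; rewrite -yE addrC subrK.
pose rho := (`|x| + 1) / d; have rho0 : 0 < rho by rewrite divr_gt0// ltr_wpDl.
exists rho; split=> //; exists (f + rho^-1 *: x); last by rewrite addrAC subrr add0r.
apply: dB; rewrite normrZ gtr0_norm ?invr_gt0// invf_div mulrAC.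
by rewrite ler_pdivrMr ?ltr_wpDl// ler_pM2l// lerDl.
Qed.

Lemma sublinear_gauge_function : sublinear psi.
Proof.
have ge0 x : 0 <= psi x by apply: le_gauge_function => rho /ltW.
split=> // [x y|s x].
  rewrite -lerBlDr; apply: le_gauge_function => a a0 Bx.
  rewrite lerBlDr -lerBlDl; apply: le_gauge_function => b b0 By.
  rewrite lerBlDl; have ab0 : 0 < a + b by exact: addr_gt0.
  apply: gauge_function_le => //.
  have t0 : 0 <= a / (a + b) by rewrite divr_ge0 ?ltW.
  have t1 : a / (a + b) <= 1 by rewrite ler_pdivrMr// mul1r lerDl ltW.
  have := convex_setP Bconv Bx By t0 t1.
  congr B; apply/matrixP => i j; rewrite !mxE; field.
  by rewrite !gt_eqF.
rewrite le_eqVlt => /predU1P[<-|s0].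
  rewrite scale0r mul0r; apply/ler_addgt0Pr => e e0; rewrite add0r.
  apply: gauge_function_le => //; rewrite scaler0.
  by apply: dB; rewrite normr0 ltW.
rewrite mulrC -ler_pdivrMr//; apply: le_gauge_function => a a0 Bx.
rewrite ler_pdivrMr//; apply: gauge_function_le; first exact: mulr_gt0.
by rewrite scalerA invfM -mulrA mulVf ?gt_eqF// mulr1.
Qed.

Lemma gauge_function_lower M : 0 < M -> (forall x, B (f + x) -> `|x| <= M) ->
  forall x, `|x| <= M * psi x.
Proof.
move=> M0 BM x; rewrite mulrC -ler_pdivrMr//; apply: le_gauge_function => a a0 Bx.
have := BM _ Bx; rewrite normrZ gtr0_norm ?invr_gt0// mulrC ler_pdivrMr// => xM.
by rewrite ler_pdivrMr// mulrC.
Qed.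

(** If a < 1 and f + (x - f) / a lies in B, then x is a convex combination of
    this point and f with positive weight 1 - a on f; so B contains the ball
    around x obtained by shrinking the one around f by 1 - a. *)
Lemma gauge_function_ge1 x : ~ B° x -> 1 <= psi (x - f).
Proof.
move=> xB; apply: le_gauge_function => a a0 Bx.
rewrite leNgt; apply/negP => a1; apply: xB.
have a1' : 0 < 1 - a by rewrite subr_gt0.
apply/nbhs_ballP; exists ((1 - a) * d) => /=; first exact: mulr_gt0.
move=> y; rewrite -ball_normE/= => xy.
have By : B (f + (1 - a)^-1 *: (y - x)).
  apply: dB; rewrite normrZ gtr0_norm ?invr_gt0// mulrC ler_pdivrMr//.
  by rewrite distrC mulrC ltW.
have := @convex_setP _ _ _ a Bconv Bx By (ltW a0) (ltW a1).
congr B; apply/matrixP => i j; rewrite !mxE; field.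
by rewrite !gt_eqF.
Qed.

End Gauge.

Lemma gauge_function_dilate (B C : set 'cV[R]_n) f (d c : R) :
    0 < d -> (forall x, `|x| <= d -> B (f + x)) -> 0 < c ->
    (forall x, B (f + x) -> C (f + c^-1 *: x)) ->
  forall x, gauge_function [set x - f | x in C] x <=
            c * gauge_function [set x - f | x in B] x.
Proof.
move=> d0 dB c0 BC x; rewrite mulrC -ler_pdivrMr//.
apply: (le_gauge_function d0 dB) => a a0 /BC; rewrite scalerA -invfM => Cx.
rewrite ler_pdivrMr// mulrC; apply: gauge_function_le => //; exact: mulr_gt0.
Qed.

Lemma periodization_dilate (psi phi : 'cV[R]_n -> R) (c : R) :
    sublinear phi -> 0 < c -> (forall x, phi x <= c * psi x) ->
  forall x, periodization phi x <= c * periodization psi x.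
Proof.
move=> phiS c0 phipsi x; rewrite mulrC -ler_pdivrMr//.
apply: le_periodization => w wZ; rewrite ler_pdivrMr// mulrC.
by apply: le_trans (phipsi _); exact: periodization_le.
Qed.

(** * Hausdorff convergence of convex bodies *)

Lemma closed_norm (A : set 'cV[R]_n) a : closed A ->
  (forall e, 0 < e -> exists2 y, A y & `|a - y| < e) -> A a.
Proof.
move=> Acl Aa; apply: Acl => U /nbhs_ballP[e /= e0 eU].
have [y Ay ay] := Aa _ e0; exists y; split=> //; apply: eU.
by rewrite -ball_normE.
Qed.

(** Fix a = f + x in the smaller ball.  From an error c with |c| <= rho, the
    point a + c is still in the large ball, hence a + c = y + c' with y in C
    and |c'| <= rho.  Iterating from c = 0 and adding up, the errors telescope:
    a differs from the average of N points of C by at most rho / N, and C is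
    closed. *)
Lemma ball_in_of_parallel (C : set 'cV[R]_n) f (d rho : R) :
    closed C -> @convex_set R 'cV[R]_n C -> 0 <= rho ->
    (forall x, `|x| <= d -> exists2 y, C y & `|f + x - y| <= rho) ->
  forall x, `|x| <= d - rho -> C (f + x).
Proof.
move=> Ccl Cconv rho0 dC x xd.
have step c : `|c| <= rho -> exists2 y, C y & `|f + x + c - y| <= rho.
  move=> crho; rewrite -addrA; apply: dC.
  by rewrite (le_trans (ler_normD _ _))// -(subrK rho d) lerD.
have avg (N : nat) : exists y c, [/\ C y, `|c| <= rho &
    N.+1%:R *: (f + x) = N.+1%:R *: y + c].
  elim: N => [|N [y [c [Cy crho E]]]].
    have [|y Cy yc] := step 0; first by rewrite normr0.
    exists y, (f + x + 0 - y); split=> //.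
    by rewrite addr0 !scale1r [RHS]addrC subrK.
  have [z Cz zc] := step _ crho.
  exists ((N.+1%:R / N.+2%:R) *: y + (1 - N.+1%:R / N.+2%:R) *: z), (f + x + c - z).
  split=> //.
    apply: convex_setP => //.
    by rewrite ler_pdivrMr// mul1r ler_nat.
  have -> : N.+2%:R *: (f + x) = N.+1%:R *: (f + x) + (f + x).
    by rewrite -natr1 scalerDl scale1r.
  rewrite E.
  apply/matrixP => i j; rewrite !mxE -!natr1; field.
  by rewrite !natr1 pnatr_eq0.
apply: closed_norm => // e e0.
pose N := Num.truncn (rho / e).
have [y [c [Cy crho E]]] := avg N; exists y => //.
have -> : f + x - y = N.+1%:R^-1 *: c.
  apply: (@scalerI _ _ N.+1%:R); first by rewrite pnatr_eq0.
  by rewrite scalerBr E scalerA divff ?pnatr_eq0// scale1r addrAC subrr add0r.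
rewrite normrZ gtr0_norm ?invr_gt0 ?ltr0n// mulrC ltr_pdivrMr ?ltr0n//.
apply: le_lt_trans crho _; rewrite mulrC -ltr_pdivrMr//.
exact: truncnS_gt.
Qed.

Lemma polytope_bounded (B : set 'cV[R]_n) : polytope B ->
  exists2 M, 0 < M & forall x, B x -> `|x| <= M.
Proof.
move=> [V /finite_seqP[s sV] ->].
pose M := 1 + \sum_(v <- s) `|v|; exists M; first by rewrite ltr_pwDl// sumr_ge0.
move=> x /(_ [set y | `|y| <= M]); apply; split.
  move=> y z t; rewrite !inE/= => yM zM.
  have t0 : 0 <= t%:num by [].
  have t1 : 0 <= 1 - t%:num by rewrite subr_ge0.
  rewrite (le_trans (ler_normD _ _))// !normrZ (ger0_norm t0) (ger0_norm t1).
  have -> : M = t%:num * M + (1 - t%:num) * M by ring.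
  by rewrite lerD// ler_wpM2l.
move=> v; rewrite sV/= => vs; rewrite /M (big_rem v vs)/=.
have : 0 <= \sum_(u <- rem v s) `|u| by exact: sumr_ge0.
lra.
Qed.

Lemma full_dimensional_nonempty (B : set 'cV[R]_n) :
  full_dimensional B -> B !=set0.
Proof.
move=> Bfull; apply/set0P/eqP => B0.
suff : affine_hull B = set0 by rewrite Bfull => /seteqP[/(_ 0)] + _; apply.
apply/seteqP; split=> // x /(_ set0); apply; split; last by rewrite B0.
by move=> y z t [].
Qed.

Lemma unit_ball_norm (x : 'cV[R]_n) : unit_ball x -> `|x| <= 1.
Proof.
rewrite /unit_ball/= /euclidean_norm => x1.
have s0 : 0 <= \sum_(i < n) x i 0 ^+ 2 by apply: sumr_ge0 => i _; exact: sqr_ge0.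
rewrite [leLHS]/Num.norm/= mx_normrE; apply/bigmax_leP; split=> // -[i j] _ /=.
rewrite (ord1 j) -sqrtr_sqr; apply: le_trans x1; rewrite ler_sqrt//.
by rewrite (bigD1 i)//= lerDl; apply: sumr_ge0 => k _; exact: sqr_ge0.
Qed.

(** The factor n + 1 is a crude bound for sqrt n, nonzero also for n = 0. *)
Lemma norm_unit_ball (x : 'cV[R]_n) : n.+1%:R * `|x| <= 1 -> unit_ball x.
Proof.
move=> x1; rewrite /unit_ball/= /euclidean_norm -sqrtr1 ler_sqrt//.
have n0 : 0 < n.+1%:R :> R by rewrite ltr0n.
have xi i : x i 0 ^+ 2 <= n.+1%:R^-1.
  rewrite -real_normK ?num_real//.
  have xin : `|x i 0| <= n.+1%:R^-1.
    by rewrite -[leRHS]mul1r ler_pdivlMr// mulrC (le_trans _ x1)// ler_pM2l// coord_le_norm.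
  rewrite expr2 -[leRHS]mulr1 ler_pM//.
  by rewrite (le_trans xin)// invf_le1// ler1n.
apply: le_trans (ler_sum _ (fun i _ => xi i)) _.
by rewrite sumr_const card_ord -[leLHS]mulr_natl ler_pdivrMr// mul1r ler_nat.
Qed.

(** Boundedness makes the set of admissible radii nonempty; on the empty set the
    infimum would be the default value 0. *)
Lemma hausdorff_distance_lt (K L : set 'cV[R]_n) (MK ML rho : R) :
    K !=set0 -> L !=set0 ->
    (forall x, K x -> `|x| <= MK) -> (forall x, L x -> `|x| <= ML) ->
    hausdorff_distance K L < rho ->
  [/\ 0 < rho, forall x, K x -> exists2 y, L y & `|x - y| <= rho
             & forall x, L x -> exists2 y, K y & `|x - y| <= rho].
Proof.
move=> [x0 Kx0] [y0 Ly0] KM LM.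
have MK0 : 0 <= MK by exact: le_trans (KM _ Kx0).
have ML0 : 0 <= ML by exact: le_trans (LM _ Ly0).
have parallel (A : set 'cV[R]_n) x y (r : R) : A y -> `|x - y| <= MK + ML ->
    n.+1%:R * (MK + ML + 1) = r -> parallel_body A r x.
  move=> Ay xy rE; exists y => //.
  have r0 : 0 < r by rewrite -rE mulr_gt0 ?ltr0n// ltr_wpDl// addr_ge0.
  exists (r^-1 *: (x - y)); last by rewrite scalerA divff ?gt_eqF// scale1r addrC subrK.
  apply: norm_unit_ball; rewrite normrZ gtr0_norm ?invr_gt0// mulrCA mulrC.
  rewrite ler_pdivrMr// mul1r -rE ler_pM2l ?ltr0n//.
  by rewrite (le_trans xy)// lerDl.
have normB (x y : 'cV[R]_n) : `|x| <= MK -> `|y| <= ML -> `|x - y| <= MK + ML.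
  by move=> xM yM; rewrite (le_trans (ler_normB _ _))// lerD.
move=> /inf_lt[].
  exists (n.+1%:R * (MK + ML + 1)); split.
  - by rewrite mulr_ge0// !addr_ge0.
  - by move=> x Kx; apply: (parallel _ _ y0) => //; apply: normB; [exact: KM|exact: LM].
  - move=> y Ly; apply: (parallel _ _ x0) => //; rewrite distrC.
    by apply: normB; [exact: KM|exact: LM].
move=> r [r0 KL LK] rrho.
have near (A : set 'cV[R]_n) x : parallel_body A r x ->
    exists2 y, A y & `|x - y| <= rho.
  move=> [y Ay [b /unit_ball_norm b1 <-]]; exists y => //.
  rewrite addrAC subrr add0r normrZ ger0_norm//.
  by apply: le_trans (ltW rrho); rewrite ler_piMr.
split; first exact: le_lt_trans rrho.
- by move=> x /KL/near.
- by move=> x /LK/near.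
Qed.

(** * Unique lifting for lattice-free polytopes *)

(** Lattice-freeness gives psi (z - f) >= 1 at integral z, and the norm bound on
    B gives a positive multiple of the norm as a lower bound for the gauge psi;
    both implications follow from these two properties and sublinearity. *)
Lemma unique_lifting_iff_symmetric (B : set 'cV[R]_n) f (d M : R) :
    lattice_free B -> 0 < d -> (forall x, `|x| <= d -> B (f + x)) ->
    (forall x, B x -> `|x| <= M) ->
  (exists! pi, minimal_lifting f (gauge_function [set x - f | x in B]) pi) <->
  periodization_symmetric f (gauge_function [set x - f | x in B]).
Proof.
move=> [_ _ Bconv Bfree] d0 dB BM.
have noZ z : Zn z -> ~ B° z.
  move=> zZ Bz; suff : set0 z by [].
  by rewrite -Bfree; exact: (conj Bz zZ).
have fB : B° f.
  apply/nbhs_ballP; exists d => //= y; rewrite -ball_normE/= => fy.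
  by rewrite -(subrK f y) addrC; apply: dB; rewrite distrC ltW.
have fZ : ~ Zn f by move=> /noZ.
have psiS := sublinear_gauge_function Bconv d0 dB.
have psi_ge1 z : Zn z -> 1 <= gauge_function [set x - f | x in B] (z - f).
  by move=> /noZ; exact: gauge_function_ge1 Bconv d0 dB _.
have M0 : 0 < M + `|f| + 1.
  rewrite ltr_wpDl// addr_ge0//; apply: le_trans (BM f _) => //.
  by have := dB 0; rewrite addr0 normr0; apply; exact: ltW.
have psi_lower : forall x, `|x| <= (M + `|f| + 1) * gauge_function [set x - f | x in B] x.
  apply: (gauge_function_lower d0 dB M0) => x /BM fxM.
  have := ler_normB (f + x) f; rewrite addrAC subrr add0r; lra.
split; first exact: unique_minimal_lifting_symmetric psi_lower.
exact: symmetric_unique_minimal_lifting.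
Qed.

End LatticeFreeLimits.

Theorem theorem4p1 (R : realType) (n : nat)
    (Bseq : nat -> set 'cV[R]_n) (B : set 'cV[R]_n)
    (hBseq : forall t : nat, maximal_lattice_free_polytope (Bseq t))
    (hB : maximal_lattice_free_polytope B)
    (hlim : hausdorff_distance (Bseq t) B @[t --> \oo] --> (0 : R))
    (hunique : forall t : nat, unique_lifting_property (Bseq t)) :
  unique_lifting_property B.
Proof.
case: hB => -[Bfree _] Bpoly f.
have [M M0 BM] := polytope_bounded Bpoly.
move=> /nbhs_ballP[d' /= d'0 d'B].
pose d := d' / 2; have d0 : 0 < d by rewrite divr_gt0.
have dB x : `|x| <= d -> B (f + x).
  move=> xd; apply: d'B; rewrite -ball_normE/= opprD addNKr normrN.
  by rewrite (le_lt_trans xd)// /d; lra.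
have [Bfull _ Bconv _] := Bfree.
apply/(unique_lifting_iff_symmetric Bfree d0 dB BM) => p.
apply/ler_addgt0Pr => e e0.
(* rho <= d / 2 keeps f interior to Bseq t; rho <= e * d makes the error of
   size rho absorbable by dilating B by 1 + e. *)
pose rho := Num.min (d / 2) (e * d).
have rho0 : 0 < rho by rewrite lt_min divr_gt0// mulr_gt0.
have rhod : rho <= d / 2 by rewrite ge_min lexx.
have rhoe : rho <= e * d by rewrite ge_min lexx orbT.
have [t ht] : exists t, hausdorff_distance (Bseq t) B < rho.
  move/cvgrPdist_lt : hlim => /(_ _ rho0)[t _ /(_ t (leqnn t))] /=.
  rewrite sub0r normrN => ht; exists t; exact: le_lt_trans (ler_norm _) ht.
have [[Cfree _] Cpoly] := hBseq t.
have [N N0 CN] := polytope_bounded Cpoly.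
have [Cfull Ccl Cconv _] := Cfree.
have [_ CB BC] := hausdorff_distance_lt (full_dimensional_nonempty Cfull)
  (full_dimensional_nonempty Bfull) CN BM ht.
have dC x : `|x| <= d - rho -> Bseq t (f + x).
  apply: ball_in_of_parallel => //; first exact: ltW.
  by move=> y /dB/BC.
have drho : 0 < d - rho by lra.
have fC : (Bseq t)° f.
  apply/nbhs_ballP; exists (d - rho) => //= y; rewrite -ball_normE/= => fy.
  by rewrite -(subrK f y) addrC; apply: dC; rewrite distrC ltW.
have /(unique_lifting_iff_symmetric Cfree drho dC CN) sym := hunique t f fC.
have e1 : 0 < 1 + e by rewrite addr_gt0.
have dilate x : Bseq t (f + x) -> B (f + (1 + e)^-1 *: x).
  (* With f + x = y + c, y in B and |c| <= e * d, the dilated point is the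
     combination of y and f + c / e with weights 1 / (1 + e), e / (1 + e). *)
  move=> /CB[y By xy].
  have Bz : B (f + e^-1 *: (f + x - y)).
    apply: dB; rewrite normrZ gtr0_norm ?invr_gt0// mulrC ler_pdivrMr// mulrC.
    exact: le_trans rhoe.
  have s0 : 0 <= (1 + e)^-1 by rewrite invr_ge0 ltW.
  have s1 : (1 + e)^-1 <= 1 by rewrite invf_le1// lerDl ltW.
  have := convex_setP Bconv By Bz s0 s1.
  congr B; apply/matrixP => i j; rewrite !mxE; field.
  by rewrite !gt_eqF.
have psiS := sublinear_gauge_function Bconv d0 dB.
have le := periodization_dilate psiS e1 (gauge_function_dilate drho dC e1 dilate).
apply: le_trans (lerD (le _) (le _)) _.
by rewrite -mulrDr -[leRHS]mulr1 ler_pM2l.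
Qed.
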